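(* Let $d\ge2$. There exists $S\subset\mathbb{T}^d$ that is approximable and that is not a subset of a simply connected subset of $\mathbb{T}^d$.
   Context: $\mathbb{T}=\{e^{is}:s\in[-\pi,\pi)\}$; $\mathbb{Z}_+$ denotes the positive integers. Let $\mathcal{P}$ be the class of polynomials of the form $P(z)=\sum_{m\in\mathbb{Z}_+^d}h_m z^m$, $z\in\mathbb{C}^d$ (finitely many non-zero coefficients $h_m\in\mathbb{C}$, $z^m=z_1^{m_1}\cdots z_d^{m_d}$). A set $\hat B\subset\mathbb{T}^d$ is approximable if $\inf_{P\in\mathcal{P}}\sup_{z\in\hat B}|1-P(z)|=0$. A path-connected set $G\subset\mathbb{T}^d$ is simply connected if for every continuous $\gamma:[0,1]\to G$ with $\gamma(0)=\gamma(1)$ there is a continuous map $T:[0,1]^2\to G$ with $T(0,\cdot)=\gamma$, $T(a,0)=T(a,1)$ for all $a$, and $T(1,\cdot)$ constant. *)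

(* Defs.v *)
From HB Require Import structures.
From mathcomp Require Import all_boot all_order all_algebra.
From mathcomp Require Import complex.
(* [mpoly] is not imported: its notations clash with those of
   [all_analysis]. *)
From mathcomp Require mpoly.
From mathcomp Require Import all_classical all_reals all_analysis.

Set Implicit Arguments.
Unset Strict Implicit.
Unset Printing Implicit Defensive.

Import Order.TTheory GRing.Theory Num.Theory.
Import numFieldNormedType.Exports.

Local Open Scope classical_set_scope.
Local Open Scope ring_scope.

(* [R[i]] at type [numFieldType], so that it and ['rV[CC R]_d] get their usual
   topologies. *)
Definition CC (R : realType) : numFieldType := R[i].

Definition circle (R : realType) : set (CC R) :=
  [set (cos s +i* sin s)%C | s in `[- pi, pi[%classic].

Arguments circle : clear implicits.

Definition torus (R : realType) (d : nat) : set 'rV[CC R]_d :=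
  [set z | forall j, circle R (z ord0 j)].
Arguments torus : clear implicits.

(* Polynomials all of whose monomials have only positive exponents; in
   particular the constant term vanishes. *)
Definition class_P (R : realType) (d : nat) : set (mpoly.mpoly d (CC R)) :=
  [set P | forall m : mpoly.multinom d, mpoly.mcoeff m P != 0 ->
             forall j, (0 < mpoly.fun_of_multinom m j)%N].
Arguments class_P : clear implicits.

Definition evalP (R : realType) (d : nat) (P : mpoly.mpoly d (CC R))
    (z : 'rV[CC R]_d) : CC R :=
  mpoly.meval (fun j => z ord0 j) P.

(* [inf] and [sup] are real-valued. For [B `<=` torus R d] polynomials are
   bounded on [B], so the only conventional value is [sup set0 = 0] when [B] is
   empty. [Normc.normc] is the modulus with values in [R]. *)
Definition approximable (R : realType) (d : nat) (B : set 'rV[CC R]_d) : Prop :=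
  inf [set sup [set Normc.normc (1 - evalP P z) | z in B]
      | P in class_P R d] = 0.

Definition path_connected (R : realType) (X : topologicalType) (G : set X) :
    Prop :=
  forall x y, G x -> G y ->
    exists f : R -> X,
      [/\ {within `[0, 1]%classic, continuous f},
          f @` `[0, 1]%classic `<=` G, f 0 = x & f 1 = y].
Arguments path_connected R {X} G.

Definition simply_connected (R : realType) (X : topologicalType) (G : set X) :
    Prop :=
  path_connected R G /\
  forall gamma : R -> X,
    {within `[0, 1]%classic, continuous gamma} ->
    gamma @` `[0, 1]%classic `<=` G ->
    gamma 0 = gamma 1 ->
    exists T : R * R -> X,
      [/\ {within `[0, 1]%classic `*` `[0, 1]%classic, continuous T},
          T @` (`[0, 1]%classic `*` `[0, 1]%classic) `<=` G,
          forall t, t \in `[0, 1] -> T (0, t) = gamma t,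
          forall a, a \in `[0, 1] -> T (a, 0) = T (a, 1) &
          exists c, forall t, t \in `[0, 1] -> T (1, t) = c].
Arguments simply_connected R {X} G.

(* Main.v *)
(* The monomial z_1 ... z_d lies in the class and equals 1 on the loop
   (e^{is}, e^{-is}, 1, ..., 1), so this loop S is approximable. If S lay in a
   simply connected subset of the torus, the loop would be null-homotopic there
   and, on the first coordinate, s |-> e^{is} would be null-homotopic in the
   circle. The winding number rules this out: cutting the circle parameter into
   n short steps, the sum of the n angle increments along the a-th loop of a
   homotopy is continuous in a and takes its values in 2 pi Z, yet it is 2 pi
   at one end and 0 at the other. *)
Require Import Defs.
From mathcomp Require Import all_boot all_order all_algebra.
From mathcomp Require Import complex ring lra.
From mathcomp Require mpoly.
From mathcomp Require Import all_classical all_reals all_analysis.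
Import Order.TTheory GRing.Theory Num.Theory.
Import numFieldNormedType.Exports.
Local Open Scope classical_set_scope.
Local Open Scope ring_scope.

(** * Angle increments between nearby points of the unit circle *)

Section AngleIncrement.
Context {R : realType} {x y x' y' : R}.
Hypotheses (xy1 : x ^+ 2 + y ^+ 2 = 1) (xy1' : x' ^+ 2 + y' ^+ 2 = 1).
Hypothesis dot_gt0 : 0 < x * x' + y * y'.

(** Lagrange's identity for the dot and cross products of two plane unit vectors. *)
Let dot_cross : (x * x' + y * y') ^+ 2 = 1 - (x * y' - y * x') ^+ 2.
Proof.
have -> : 1 = (x ^+ 2 + y ^+ 2) * (x' ^+ 2 + y' ^+ 2) :> R.
  by rewrite xy1 xy1' mulr1.
by ring.
Qed.

Lemma cross_itv : -1 < x * y' - y * x' < 1.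
Proof.
rewrite -ltr_norml -(@expr_lt1 _ 2)// real_normK ?num_real//.
by rewrite -subr_gt0 -dot_cross exprn_gt0.
Qed.

Let cross_itvW : -1 <= x * y' - y * x' <= 1.
Proof. by case/andP: cross_itv => *; apply/andP; split; exact: ltW. Qed.

(** The cross product is the sine of the angle between the vectors. As the dot product is positive,
    it is the cosine of [t] itself and not only up to sign, so rotation by [t] takes the first
    vector to the second. *)
Lemma rotate_asin_cross (t := asin (x * y' - y * x')) :
  x' = x * cos t - y * sin t /\ y' = y * cos t + x * sin t.
Proof.
rewrite /t asinK ?in_itv//= cos_asin// -dot_cross sqrtr_sqr gtr0_norm//.
split.
  by rewrite -[LHS]mul1r -xy1; ring.
by rewrite -[LHS]mul1r -xy1; ring.
Qed.

End AngleIncrement.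

(** * The winding number along a homotopy in the circle *)

(** At [s = 0] the dot product is 1, so it stays positive near each point; compactness of the unit
    square makes the bound on [s] uniform. The time [t + s] may leave the unit interval, hence [X]
    and [Y] live on the whole plane. *)
Lemma cross_pos_near (R : realType) (X Y : R * R -> R) :
  continuous X -> continuous Y -> (forall p, X p ^+ 2 + Y p ^+ 2 = 1) ->
  \forall s \near (0 : R), forall (a t : R), a \in `[0, 1] -> t \in `[0, 1] ->
    0 < X (a, t) * X (a, t + s) + Y (a, t) * Y (a, t + s).
Proof.
move=> cX cY XY1.
pose F (q : (R * R) * R) : R :=
  X q.1 * X (q.1.1, q.1.2 + q.2) + Y q.1 * Y (q.1.1, q.1.2 + q.2).
have cF : continuous F.
  have cshift : continuous (fun q : (R * R) * R => (q.1.1, q.1.2 + q.2)).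
    move=> q.
    have c1 : {for q, continuous (fun q : (R * R) * R => q.1.1)}.
      apply: (@continuous_comp _ _ _ fst fst); exact: cvg_fst.
    have c2 : {for q, continuous (fun q : (R * R) * R => q.1.2 + q.2)}.
      apply: cvgD; last exact: cvg_snd.
      apply: (@continuous_comp _ _ _ fst snd); [exact: cvg_fst|exact: cvg_snd].
    exact: (cvg_pair c1 c2).
  move=> q; apply: cvgD; apply: cvgM.
  - apply: (@continuous_comp _ _ _ fst X); [exact: cvg_fst|exact: cX].
  - by apply: (@continuous_comp _ _ _ _ X); [exact: cshift|exact: cX].
  - apply: (@continuous_comp _ _ _ fst Y); [exact: cvg_fst|exact: cY].
  - by apply: (@continuous_comp _ _ _ _ Y); [exact: cshift|exact: cY].
have cK : compact (`[0, 1]%classic `*` `[0, 1]%classic : set (R * R)).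
  by apply: compact_setX; exact: segment_compact.
have H (p : R * R) : \forall p' \near p & s \near (0:R), 0 < F (p', s).
  have : 0 < F (p, 0).
    by rewrite /F /= addr0 -surjective_pairing -!expr2 XY1.
  by move=> /(cvgr_gt _ (cF (p, 0))).
have := (compact_near_coveringP _).1 cK R (nbhs (0 : R))
  (fun s p => 0 < F (p, s)) (nbhs_filter _) (fun p _ => H p).
apply: filterS => s sK a t aI tI.
by apply: (sK (a, t)).
Qed.

(** The dot product of a unit vector with its image under rotation by [t] is [cos t]. *)
Lemma rotation_fixed_cos {R : realType} {x y t : R} : x ^+ 2 + y ^+ 2 = 1 ->
  x = x * cos t - y * sin t -> y = y * cos t + x * sin t -> cos t = 1.
Proof.
move=> xy1 ex ey.
have : (x ^+ 2 + y ^+ 2) * cos t =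
       x * (x * cos t - y * sin t) + y * (y * cos t + x * sin t) by ring.
by rewrite -ex -ey -!expr2 xy1 mul1r.
Qed.

Lemma circle_loop_not_null_homotopic (R : realType) (X Y : R * R -> R)
    (c c' : R) :
  continuous X -> continuous Y -> (forall p, X p ^+ 2 + Y p ^+ 2 = 1) ->
  (forall a, a \in `[0, 1] -> X (a, 0) = X (a, 1) /\ Y (a, 0) = Y (a, 1)) ->
  (forall t, t \in `[0, 1] -> X (0, t) = cos (2 * pi * t - pi) /\
                              Y (0, t) = sin (2 * pi * t - pi)) ->
  (forall t, t \in `[0, 1] -> X (1, t) = c /\ Y (1, t) = c') ->
  False.
Proof.
move=> cX cY XY1 loop start stop.
(* There are [n.+1] steps, hence at least four: each step of the initial loop then turns by at most
   a right angle, where [asin] inverts [sin]. *)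
have [n [n3 dot_gt0]] : exists n, (3 <= n)%N /\
    forall (a t : R), a \in `[0, 1] -> t \in `[0, 1] ->
    0 < X (a, t) * X (a, t + n.+1%:R^-1) + Y (a, t) * Y (a, t + n.+1%:R^-1).
  have /filter_ex [n [? ?]] : \forall n \near \oo, (3 <= n)%N /\
    forall (a t : R), a \in `[0, 1] -> t \in `[0, 1] ->
    0 < X (a, t) * X (a, t + n.+1%:R^-1) + Y (a, t) * Y (a, t + n.+1%:R^-1).
    apply: filterI; first exact: nbhs_infty_ge.
    exact: (@cvg_harmonic R _ (@cross_pos_near R X Y cX cY XY1)).
  by exists n.
set h := n.+1%:R^-1 in dot_gt0.
have n0 : (n.+1%:R : R) != 0 by rewrite pnatr_eq0.
have h0 : 0 <= h by rewrite invr_ge0.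
have nh : n.+1%:R * h = 1 by rewrite /h mulfV.
have gridI (k : nat) : (k <= n.+1)%N -> k%:R * h \in `[0, 1].
  move=> kn; rewrite in_itv/= mulr_ge0//= -[leRHS]nh ler_wpM2r// ler_nat//.
have gridS (k : nat) : k.+1%:R * h = k%:R * h + h.
  by rewrite -natr1 mulrDl mul1r.
pose dot a (k : nat) :=
  X (a, k%:R * h) * X (a, k.+1%:R * h) + Y (a, k%:R * h) * Y (a, k.+1%:R * h).
pose cross a (k : nat) :=
  X (a, k%:R * h) * Y (a, k.+1%:R * h) - Y (a, k%:R * h) * X (a, k.+1%:R * h).
have dot0 a (k : 'I_n.+1) : a \in `[0, 1] -> 0 < dot a k.
  move=> aI; rewrite /dot gridS; apply: dot_gt0 => //.
  by apply: gridI; apply: ltnW.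
(* The total angle swept by the [a]-th loop during its first [m] steps. *)
pose w m a := \sum_(k < m) asin (cross a k).
have rot a m : a \in `[0, 1] -> (m <= n.+1)%N ->
  X (a, m%:R * h) = X (a, 0) * cos (w m a) - Y (a, 0) * sin (w m a) /\
  Y (a, m%:R * h) = Y (a, 0) * cos (w m a) + X (a, 0) * sin (w m a).
  move=> aI; elim: m => [_|m IHm mn].
    by rewrite /w big_ord0 cos0 sin0 !mul0r !mulr0 !mulr1 subr0 addr0.
  have [IX IY] := IHm (ltnW mn).
  have [eX eY] := rotate_asin_cross (XY1 _) (XY1 _) (dot0 a (Ordinal mn) aI).
  rewrite /w big_ord_recr /= -/(w m a) cosD sinD.
  by split; [rewrite [LHS]eX|rewrite [LHS]eY]; rewrite /cross IX IY; ring.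
(* The loop closes up, so rotation by the total angle fixes its base point; this puts the angle in
   $2\pi\mathbb{Z}$. *)
have cosw a : a \in `[0, 1] -> cos (w n.+1 a) = 1.
  move=> aI; have := rot a _ aI (leqnn _); rewrite nh.
  have [<- <-] := loop a aI.
  by case=> ? ?; apply: rotation_fixed_cos (XY1 (a, 0)) _ _.
have w1 : w n.+1 1 = 0.
  rewrite /w big1// => k _.
  have -> : cross 1 k = 0.
    have [e1 e2] := stop _ (gridI _ (ltnW (ltn_ord k))).
    have [e3 e4] := stop _ (gridI _ (ltn_ord k)).
    by rewrite /cross e1 e2 e3 e4 mulrC subrr.
  by rewrite -[in LHS]sin0 sinK// in_itv/=; have := pi_gt0 R; lra.
have w0 : w n.+1 0 = 2 * pi.
  rewrite /w (eq_bigr (fun=> 2 * pi * h)); last first.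
    move=> k _; rewrite /cross.
    have [-> ->] := start _ (gridI _ (ltnW (ltn_ord k))).
    have [-> ->] := start _ (gridI _ (ltn_ord k)).
    rewrite [X in asin X](_ : _ = sin (2 * pi * h)); last first.
      have -> : 2 * pi * h =
          2 * pi * (k.+1%:R * h) - pi - (2 * pi * (k%:R * h) - pi).
        by rewrite gridS; ring.
      by rewrite [RHS]sinB; ring.
    rewrite sinK// in_itv/=.
    have pi0 := pi_gt0 R.
    have h4 : 4 * h <= 1 by rewrite -[leRHS]nh ler_wpM2r// ler_nat.
    apply/andP; split; nra.
  by rewrite sumr_const card_ord -[LHS]mulr_natl mulrCA nh mulr1.
(* Positive dot products keep the cross products strictly between -1 and 1, where [asin] is
   continuous. *)
have cw : {within `[0, 1], continuous (w n.+1)}.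
  apply: continuous_in_subspaceT => a; rewrite inE => aI.
  rewrite /w.
  apply: cvg_big => [|k _]; first exact: add_continuous.
  have cpt (Z : R * R -> R) t : continuous Z ->
      {for a, continuous (fun a => Z (a, t))}.
    move=> cZ.
    apply: (@continuous_comp _ _ _ (fun a => (a, t)) Z); last exact: cZ.
    have c1 : {for a, continuous (id : R -> R)} by [].
    exact: (cvg_pair c1 (cvg_cst t)).
  apply: (@continuous_comp _ _ _ (cross^~ k) asin).
    by apply: cvgB; apply: cvgM; exact: cpt.
  apply: continuous_asin.
  exact: cross_itv (XY1 _) (XY1 _) (dot0 a k aI).
(* The total angle would take the value [pi], whose cosine is -1. *)
have [|a aI wa] := IVT (v := pi) ler01 cw.
  by rewrite w0 w1 ge_min le_max; have := pi_gt0 R; lra.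
have := cosw a aI; rewrite wa cospi; lra.
Qed.

(** * Complex coordinates and their continuity *)

Lemma real_complex_continuous (R : realType) :
  continuous (fun x : R => x%:C%C : CC R).
Proof.
move=> x; apply/(@cvgrPdist_lt (CC R) (CC R)) => e e0.
(* In the order on complex numbers a positive radius is necessarily real. *)
have [Re0 ->] : 0 < complex.Re e /\ e = (complex.Re e)%:C%C.
  by case: e e0 => a b; rewrite ltcE /= => /andP[/eqP -> ->].
move/cvgrPdist_lt: (@cvg_id _ (nbhs x)) => /(_ _ Re0).
apply: filterS => y xy.
have -> : (x%:C%C - y%:C%C : CC R) = (x - y)%:C%C :> R[i] by rewrite rmorphB.
by rewrite normc_def /= expr0n/= addr0 sqrtr_sqr ltcR.
Qed.

Lemma Re_continuous (R : realType) : continuous (@complex.Re R : CC R -> R).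
Proof.
move=> z V /(@nbhs_ballP R R) [e /= e0 eV].
apply/(@nbhs_ballP (CC R) (CC R)); exists (e%:C%C : CC R) => [|w zw].
  by rewrite /= ltcR.
apply: eV; move: zw; rewrite -!ball_normE /= => zw.
by rewrite -raddfB -ltcR; apply: le_lt_trans zw; exact: normc_ge_Re.
Qed.

Lemma continuous_Complex (R : realType) (f g : R -> R) :
  continuous f -> continuous g ->
  continuous (fun t => (f t +i* g t)%C : CC R).
Proof.
move=> cf cg t.
rewrite (_ : (fun t => _) = (fun t =>
  ((f t)%:C%C : CC R) + ('i%C : CC R) * ((g t)%:C%C : CC R))); last first.
  by apply/funext => x; rewrite [LHS]complexE.
apply: cvgD; last apply: cvgM; first 1 last.
- exact: cvg_cst.
- by apply: (@continuous_comp _ _ _ g);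
    [exact: cg|exact: real_complex_continuous].
- by apply: (@continuous_comp _ _ _ f);
    [exact: cf|exact: real_complex_continuous].
Qed.

Lemma Im_continuous (R : realType) : continuous (@complex.Im R : CC R -> R).
Proof.
move=> z.
rewrite (_ : @complex.Im R = @complex.Re R \o *%R (- 'i%C : CC R)); last first.
  by apply/funext => -[a b] /=; ring.
apply: (@continuous_comp (CC R) (CC R) R); last exact: Re_continuous.
exact: (@mulrl_continuous (CC R)).
Qed.

Lemma circle_ReIm (R : realType) (z : CC R) :
  circle R z -> complex.Re z ^+ 2 + complex.Im z ^+ 2 = 1.
Proof. by case=> s _ <-; rewrite /= cos2Dsin2. Qed.

(** The endpoint [pi], outside the half-open parameter interval, gives the same point as [- pi]. *)
Lemma circle_cis (R : realType) (s : R) :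
  s \in `[- pi, pi] -> circle R (cos s +i* sin s)%C.
Proof.
rewrite in_itv/= => /andP[spi]; rewrite le_eqVlt => /orP[/eqP ->|slt].
  exists (- pi); first by rewrite /= in_itv/= lexx; have := pi_gt0 R; lra.
  by rewrite cosN sinN sinpi oppr0.
by exists s => //=; rewrite in_itv/= spi.
Qed.

(** * Extending homotopies from the square to the plane *)

(** The retraction of the line onto the unit interval; precomposing with it turns continuity within
    the square into continuity on the plane. *)
Definition unit_clamp {R : realType} (t : R) : R := Num.max 0 (Num.min t 1).

Lemma unit_clamp_itv (R : realType) (t : R) : unit_clamp t \in `[0, 1].
Proof.
by rewrite in_itv/= /unit_clamp le_max lexx/= ge_max ler01 ge_min lexx orbT.
Qed.

Lemma unit_clamp_id (R : realType) (t : R) : t \in `[0, 1] -> unit_clamp t = t.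
Proof.
by rewrite in_itv/= /unit_clamp => /andP[t0 t1]; rewrite min_l// max_r.
Qed.

Lemma unit_clamp_continuous (R : realType) : continuous (@unit_clamp R).
Proof.
move=> t; apply: (@continuous_max R R (fun=> 0) (fun t => Num.min t 1)).
  exact: cvg_cst.
by apply: (@continuous_min R R id (fun=> 1)); [exact: cvg_id|exact: cvg_cst].
Qed.

Lemma continuous_row (R : realType) d (f : R -> 'rV[CC R]_d) :
  (forall j, continuous (fun t => f t ord0 j)) -> continuous f.
Proof.
move=> cf t; apply/cvg_mx_entourageP => A entA.
apply: filter_forall => i; apply: filter_forall => j.
rewrite (ord1 i).
have h := (cvg_entourageP _ _).1 (cf j t) A entA.
rewrite !near_simpl in h *.
have := h (fmap_filter _ (nbhs_filter t)); apply: filterS => s /=.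
by rewrite inE.
Qed.

Lemma within_square_clamp (R : realType) (U : topologicalType)
    (T : R * R -> U) :
  {within `[0, 1]%classic `*` `[0, 1]%classic, continuous T} ->
  continuous (fun p => T (unit_clamp p.1, unit_clamp p.2)).
Proof.
move=> cT p.
pose c (p : R * R) := (unit_clamp p.1, unit_clamp p.2).
have cc : continuous c.
  move=> q.
  have c1 : {for q, continuous (fun q : R * R => unit_clamp q.1)}.
    by apply: (@continuous_comp _ _ _ fst unit_clamp);
      [exact: cvg_fst|exact: unit_clamp_continuous].
  have c2 : {for q, continuous (fun q : R * R => unit_clamp q.2)}.
    by apply: (@continuous_comp _ _ _ snd unit_clamp);
      [exact: cvg_snd|exact: unit_clamp_continuous].
  exact: (cvg_pair c1 c2).
have cI q : (`[0, 1]%classic `*` `[0, 1]%classic : set (R * R)) (c q).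
  by split; exact: unit_clamp_itv.
move/subspace_continuousP : cT => cT V /(cT _ (cI p)) /(cc p).
by rewrite /= => h;
  apply: (@filterS _ _ (nbhs_filter p)) h => q; apply; exact: cI.
Qed.

(** * Approximability by a single monomial *)

Lemma normc_ge0 (R : realType) (z : R[i]) : 0 <= Normc.normc z.
Proof. by case: z => a b; exact: sqrtr_ge0. Qed.

Lemma approximable_prod1 (R : realType) (d : nat) (S : set 'rV[CC R]_d) :
  (forall z, S z -> \prod_j z ord0 j = 1) -> approximable S.
Proof.
move=> S1; rewrite /approximable; set E := (X in inf X = 0).
have E_ge0 : lbound E 0.
  move=> _ [P _ <-]; set N := (X in sup X).
  (* Without a supremum, [sup] takes its default value 0, which also satisfies the bound. *)
  have [supN|supN] := pselect (has_sup N); last by rewrite sup_out.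
  have [[_ [z Sz _]] _] := supN.
  by apply: (le_trans (normc_ge0 _ _)); apply: sup_upper_bound => //; exists z.
pose m : mpoly.multinom d := mpoly.Multinom [tuple 1%N | i < d].
have E0 : E 0.
  exists (mpoly.mpolyX (CC R) m).
    move=> k; rewrite mpoly.mcoeffX pnatr_eq0 eqb0 negbK => /eqP <- j.
    by rewrite mpoly.mnmE.
  have eval1 z : S z -> evalP (mpoly.mpolyX (CC R) m) z = 1.
    move=> Sz; rewrite /evalP mpoly.mevalX -[RHS](S1 z Sz).
    by apply: eq_bigr => j _; rewrite mpoly.mnmE expr1.
  (* For empty [S] the value 0 is again the default of [sup]. *)
  have [[z0 Sz0]|S0] := pselect (S !=set0).
    rewrite (_ : [set _ | z in S] = [set 0]) ?sup1//.
    apply/seteqP; split=> [_ [z Sz <-]|_ ->].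
      by rewrite /= eval1// subrr Normc.normc0.
    by exists z0 => //; rewrite eval1// subrr Normc.normc0.
  rewrite sup_out// => -[[_ [z Sz _]] _].
  by apply: S0; exists z.
apply/eqP; rewrite eq_le; apply/andP; split.
  by apply: ge_inf => //; exists 0.
by apply: lb_le_inf => //; exists 0.
Qed.

(** * The winding loop in the torus *)

(** The [j]-th coordinate of a contraction in [G], clamped to the plane, would contract a loop of
    winding number one in the circle. *)
Lemma winding_loop_not_simply_connected (R : realType) (d : nat) (j : 'I_d)
    (G : set 'rV[CC R]_d) (gamma : R -> 'rV[CC R]_d) :
  G `<=` torus R d -> continuous gamma ->
  gamma @` `[0, 1]%classic `<=` G -> gamma 0 = gamma 1 ->
  (forall t, gamma t ord0 j =
    (cos (2 * pi * t - pi) +i* sin (2 * pi * t - pi))%C) ->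
  ~ simply_connected R G.
Proof.
move=> Gtorus cgamma gammaG gamma01 gammaE [_ contract].
have [|T [cT TG T0 Tloop [c T1]]] := contract gamma _ gammaG gamma01.
  exact: continuous_subspaceT.
pose Z p := T (unit_clamp p.1, unit_clamp p.2) ord0 j.
have cZ : continuous Z.
  move=> p; apply: (@continuous_comp _ _ _ _ (fun z : 'rV[CC R]_d => z ord0 j)).
    exact: (within_square_clamp _ _ _ cT).
  exact: coord_continuous.
have clamp0 : unit_clamp 0 = 0 :> R.
  by rewrite unit_clamp_id// in_itv/= lexx ler01.
have clamp1 : unit_clamp 1 = 1 :> R.
  by rewrite unit_clamp_id// in_itv/= lexx ler01.
apply: (@circle_loop_not_null_homotopic R (fun p => complex.Re (Z p))
  (fun p => complex.Im (Z p)) (complex.Re (c ord0 j)) (complex.Im (c ord0 j))).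
- by move=> p; apply: (@continuous_comp _ _ _ Z (@complex.Re R));
    [exact: cZ|exact: Re_continuous].
- by move=> p; apply: (@continuous_comp _ _ _ Z (@complex.Im R));
    [exact: cZ|exact: Im_continuous].
- move=> p; apply: circle_ReIm; apply: Gtorus; apply: TG.
  by exists (unit_clamp p.1, unit_clamp p.2) => //;
    split; exact: unit_clamp_itv.
- by move=> a aI; rewrite /Z/= clamp0 clamp1 Tloop// unit_clamp_itv.
- by move=> t tI; rewrite /Z/= clamp0 unit_clamp_id// T0// gammaE.
- by move=> t tI; rewrite /Z/= clamp1 unit_clamp_id// T1.
Qed.

Theorem proposition5 (R : realType) (d : nat) (hd : (2 <= d)%N) :
  exists S : set 'rV[CC R]_d,
    [/\ S `<=` torus R d, approximable S &
        ~ exists G : set 'rV[CC R]_d,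
            [/\ G `<=` torus R d, simply_connected R G & S `<=` G]].
Proof.
case: d hd => [|[|n]] // _.
pose angle (t : R) : R := 2 * pi * t - pi.
(* The first two coordinates are conjugate and the others are 1, so the product is 1 all along the
   loop. *)
pose gamma t : 'rV[CC R]_n.+2 :=
  \row_j (if j == 0 :> nat then (cos (angle t) +i* sin (angle t))%C
          else if j == 1 :> nat then (cos (- angle t) +i* sin (- angle t))%C
          else 1).
have cangle : continuous angle.
  move=> t; apply: cvgB; last exact: cvg_cst.
  by apply: cvgM; [exact: cvg_cst|exact: cvg_id].
have cgamma : continuous gamma.
  apply: continuous_row => j.
  under eq_fun do rewrite mxE.
  case: (j == 0 :> nat); last case: (j == 1 :> nat).
  - apply: continuous_Complex => t; apply: (@continuous_comp _ _ _ angle);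
    [exact: cangle|exact: continuous_cos|exact: cangle|exact: continuous_sin].
  - apply: continuous_Complex => t.
      apply: (@continuous_comp _ _ _ (fun t => - angle t) cos);
        last exact: continuous_cos.
      by apply: cvgN; exact: cangle.
    apply: (@continuous_comp _ _ _ (fun t => - angle t) sin);
      last exact: continuous_sin.
    by apply: cvgN; exact: cangle.
  - by move=> t; exact: cvg_cst.
exists (gamma @` `[0, 1]); split.
- move=> _ [t /= tI <-] j; rewrite mxE.
  have [pi0 [sI sNI]] : 0 < (pi : R) /\
      angle t \in `[- pi, pi] /\ - angle t \in `[- pi, pi].
    have pi0 := pi_gt0 R.
    move: tI; rewrite !in_itv/= /angle => /andP[t0 t1].
    by split => //; split; apply/andP; split; nra.
  case: ifP => _; first exact: circle_cis.
  case: ifP => _; first exact: circle_cis.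
  rewrite (_ : 1 = (cos 0 +i* sin 0)%C); last by rewrite cos0 sin0.
  by apply: circle_cis; rewrite in_itv/=; lra.
- apply: approximable_prod1 => _ [t _ <-].
  rewrite big_ord_recl big_ord_recl big1 => [|j _]; last by rewrite mxE.
  rewrite mulr1 !mxE /= cosN sinN.
  apply/eqP; rewrite eq_complex /=.
  have := cos2Dsin2 (angle t); rewrite !expr2 => e.
  by apply/andP; split; apply/eqP; lra.
- case=> G [Gtorus scG SG].
  apply: (@winding_loop_not_simply_connected R _ ord0 G gamma) scG => //.
    apply/rowP => j; rewrite !mxE.
    have -> : angle 0 = - pi by rewrite /angle; ring.
    have -> : angle 1 = pi by rewrite /angle; ring.
    by rewrite opprK cosN sinN sinpi oppr0.
  by move=> t; rewrite mxE.
Qed.
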